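(* Let $X,Y$ be normed spaces, let $f\in\mathcal{PL}(X,Y)$, and let $(P_1,T_1,b_1),\dots,(P_m,T_m,b_m)$ be such that each $P_i$ is a polyhedron in $X$, $T_i\in\mathcal{L}(X,Y)$, $b_i\in Y$, $X=\bigcup_{i=1}^mP_i$, $\mathrm{int}(P_i)\neq\emptyset$ for all $i$, $P_i\cap\mathrm{int}(P_j)=\emptyset$ for all $i\neq j$, and $f(x)=T_i(x)+b_i$ for all $x\in P_i$ and all $i$. Let $X_f:=\bigcap_{i=1}^m\mathrm{lin}(P_i)$. Let $X_1$ and $X_2$ be closed subspaces of $X$ such that $$X_1\subset X_f,\qquad X=X_1\oplus X_2,\qquad \mathrm{codim}(X_1)=\dim(X_2)<\infty.$$ Then there exist $T\in\mathcal{L}(X_1,Y)$, a finite dimensional subspace $\hat Y$ of $Y$ and $g\in\mathcal{PL}(X_2,\hat Y)$ such that $$f(x_1+x_2)=T(x_1)+g(x_2)\quad\text{for all }(x_1,x_2)\in X_1\times X_2.$$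
   Context: $\mathcal{L}(X,Y)$ is the space of continuous linear operators from $X$ to $Y$. A polyhedron in a normed space $Z$ is a set $\{z\in Z:\langle u_i^*,z\rangle\le s_i,\ i=1,\dots,n\}$ with finitely many $u_i^*\in Z^*$, $s_i\in\mathbb{R}$. $\mathcal{PL}(X,Y)$ is the set of functions $f:X\to Y$ for which there are finitely many polyhedra $P_i$ in $X$ with $X=\bigcup_iP_i$, operators $T_i\in\mathcal{L}(X,Y)$ and points $b_i\in Y$ with $f(x)=T_i(x)+b_i$ for all $x\in P_i$. For a convex set $K$, $\mathrm{rec}(K):=\{h: K+\mathbb{R}_+h\subset K\}$ and $\mathrm{lin}(K):=(-\mathrm{rec}(K))\cap\mathrm{rec}(K)$. $X=X_1\oplus X_2$ means $X=X_1+X_2$ and $X_1\cap X_2=\{0\}$. *)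

(* Defs.v *)
From HB Require Import structures.
From mathcomp Require Import all_boot all_order all_algebra.
From mathcomp Require Import all_classical all_reals all_analysis.

Set Implicit Arguments.
Unset Strict Implicit.
Unset Printing Implicit Defensive.

Import Order.TTheory GRing.Theory Num.Theory.
Import numFieldNormedType.Exports.

Local Open Scope classical_set_scope.
Local Open Scope ring_scope.

(* A linear subspace of X is a [submodClosed X]; [sub_normed V] is V viewed as *)
(* a normed space in its own right, with the norm induced by X.                *)
Section SubNormed.
Context (R : realType) (X : normedModType R) (V : submodClosed X).

Record sub_normed := SubNormed { sub_val : X; sub_valP : sub_val \in V }.

HB.instance Definition _ := [isSub for sub_val].
HB.instance Definition _ := [Choice of sub_normed by <:].
HB.instance Definition _ := [SubChoice_isSubLmodule of sub_normed by <:].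

Let sub_norm (v : sub_normed) : R := `|val v|.

Let sub_norm_triangle (v w : sub_normed) :
  sub_norm (v + w) <= sub_norm v + sub_norm w.
Proof. by rewrite /sub_norm raddfD ler_normD. Qed.

Let sub_normZ (a : R) (v : sub_normed) : sub_norm (a *: v) = `|a| * sub_norm v.
Proof. by rewrite /sub_norm linearZ normrZ. Qed.

Let sub_norm0_eq0 (v : sub_normed) : sub_norm v = 0 -> v = 0.
Proof. by move=> /normr0_eq0 v0; apply: val_inj; rewrite v0 raddf0. Qed.

HB.instance Definition _ := Lmodule_isNormed.Build R sub_normed
  sub_norm_triangle sub_normZ sub_norm0_eq0.

Lemma sub_normE (v : sub_normed) : `|v| = `|val v|.
Proof. by []. Qed.

End SubNormed.

Section LinearAlgebra.
Context (R : realType).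

Definition has_dim (E : lmodType R) (n : nat) : Prop :=
  exists e : 'I_n -> E,
    forall x : E, exists! c : {ffun 'I_n -> R}, x = \sum_i c i *: e i.

(* codim V = dim (E / V): the classes of the e i form a basis of E / V *)
Definition has_codim (E : lmodType R) (V : submodClosed E) (n : nat) : Prop :=
  exists e : 'I_n -> E,
    forall x : E, exists! c : {ffun 'I_n -> R}, x - \sum_i c i *: e i \in V.

Definition direct_sum (E : lmodType R) (V W : submodClosed E) : Prop :=
  [set x | exists v w, [/\ v \in V, w \in W & x = v + w]] = [set: E] /\
  [set` V] `&` [set` W] = [set 0].

Definition rec_cone (E : lmodType R) (K : set E) : set E :=
  [set h | forall (x : E) (t : R), K x -> 0 <= t -> K (x + t *: h)].

Definition lin_space (E : lmodType R) (K : set E) : set E :=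
  (-%R @` rec_cone K) `&` rec_cone K.

End LinearAlgebra.

Section PiecewiseLinear.
Context (R : realType).

Definition polyhedron (Z : normedModType R) (P : set Z) : Prop :=
  exists (n : nat) (u : 'I_n -> {linear Z -> R^o}) (s : 'I_n -> R),
    (forall i, continuous (u i)) /\
    P = [set z | forall i, (u i z : R) <= s i].

Definition pl_repr (X Y : normedModType R) (f : X -> Y) (m : nat)
    (P : 'I_m -> set X) (T : 'I_m -> {linear X -> Y}) (b : 'I_m -> Y) : Prop :=
  [/\ forall i, polyhedron (P i),
      forall i, continuous (T i),
      \bigcup_i P i = [set: X] &
      forall i x, P i x -> f x = T i x + b i].

Definition PL (X Y : normedModType R) : set (X -> Y) :=
  [set f | exists m P T b, @pl_repr X Y f m P T b].

End PiecewiseLinear.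

Arguments PL {R} X Y.

(* Main.v *)
Require Import Defs.
From HB Require Import structures.
From mathcomp Require Import all_boot all_order all_algebra.
From mathcomp Require Import all_classical all_reals all_analysis.

Set Implicit Arguments.
Unset Strict Implicit.
Unset Printing Implicit Defensive.

Import Order.TTheory GRing.Theory Num.Theory.
Import numFieldNormedType.Exports.

Local Open Scope classical_set_scope.
Local Open Scope ring_scope.

(* For h in X_1, the map x |-> f (x + h) - f x equals T_i h on P_i, so it takes
   finitely many values, each on a closed set; X being connected, it is constant.
   Hence all the T_i agree on X_1 and f (x1 + x2) = f x2 + T_i x1 for any i. The
   restriction of f to X_2 takes its values in the span of the b_i and of the
   images under the T_i of a basis of X_2. *)

Section ConnectedSpace.
Context (R : realType) (X : normedModType R).

(** Pulling [A] back along the line [l] through [x] and [y] reduces the claim to the connectedness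
    of the real line. *)
Lemma clopen_normedModType_mem (A : set X) (x y : X) :
  open A -> closed A -> A x -> A y.
Proof.
move=> oA cA Ax; pose l (t : R) : X := x + t *: (y - x).
have cl : continuous l.
  move=> t; apply: cvgD; first exact: cvg_cst.
  by apply: cvgZr_tmp; exact: cvg_id.
suff lT : l @^-1` A = [set: R].
  have : (l @^-1` A) 1 by rewrite lT.
  by rewrite /= /l scale1r addrC subrK.
(* The preimage contains 0 because [l 0 = x], and it is both open and closed by continuity of
   [l]. *)
have := (connected_intervalP [set: R]).2 (fun _ _ _ _ _ _ => I); apply.
- by exists 0; rewrite /= /l scale0r addr0.
- by exists (l @^-1` A); [exact: (continuousP l).1|rewrite setTI].
- by exists (l @^-1` A); [exact: (continuous_closedP l).1|rewrite setTI].
Qed.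

(* The fibre over [c] and its complement are both finite unions of pieces. *)
Lemma closed_cover_const (C : Type) (I : finType) (P : I -> set X) (F : X -> C)
    (c : I -> C) : (forall i, closed (P i)) -> \bigcup_i P i = [set: X] ->
  (forall i x, P i x -> F x = c i) -> forall x y, F x = F y.
Proof.
move=> Pc Pcov FP x y.
have piece z : exists i, P i z.
  by have : [set: X] z by []; rewrite -Pcov => -[i _ Piz]; exists i.
have cvr (S : set C) : F @^-1` S = \bigcup_(i in c @^-1` S) P i.
  apply/seteqP; split=> z /=.
    by have [i Piz] := piece z; rewrite (FP i)// => Sc; exists i.
  by case=> i Sc Piz; rewrite (FP i).
have clF (S : set C) : closed (F @^-1` S).
  by rewrite cvr; apply: closed_bigcup => [|i _]; [exact: finite_finset|].
suff : (F @^-1` [set F x]) y by move=> /= ->.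
apply: (@clopen_normedModType_mem _ x) => //.
by rewrite -closedC preimage_setC.
Qed.

End ConnectedSpace.

Lemma polyhedron_closed (R : realType) (Z : normedModType R) (P : set Z) :
  polyhedron P -> closed P.
Proof.
case=> n [u [s [uc ->]]].
rewrite (_ : mkset _ = \bigcap_i (u i @^-1` [set r : R^o | (r : R) <= s i])).
  apply: closed_bigI => i _.
  by apply: (continuous_closedP (u i)).1 => //; exact: closed_le.
by apply/seteqP; split=> z /= Pz i; [move=> _|]; exact: Pz.
Qed.

Section Span.
Context (R : realType) (E : lmodType R).

(* A spanning family of minimal size is a basis. *)
Lemma has_dim_spanning (I : finType) (v : I -> E) :
  (forall x, exists c : I -> R, x = \sum_i c i *: v i) ->
  exists n, has_dim E n.
Proof.
move=> vE.
pose spans n (e : 'I_n -> E) := forall x, exists c : 'I_n -> R,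
  x = \sum_i c i *: e i.
have exn : exists n, `[< exists e : 'I_n -> E, spans n e >].
  exists #|I|; apply/asboolP; exists (v \o enum_val) => x.
  have [c ->] := vE x; exists (c \o enum_val).
  by rewrite (reindex_onto enum_val enum_rank) => [|i _];
    [under eq_bigl do rewrite enum_valK eqxx|rewrite enum_rankK].
case: (ex_minnP exn) => n /asboolP[e eE] nmin; exists n, e => x.
have [c xc] := eE x; exists [ffun i => c i]; split=> [|d xd].
  by rewrite xc; apply: eq_bigr => i _; rewrite ffunE.
apply/ffunP => k; rewrite ffunE; apply/eqP/contraT => cdk.
have {}cdk : c k - d k != 0 by rewrite subr_eq0.
case: n => [|n] in e eE nmin c xc d xd k cdk *; first by case: k cdk.
have : \sum_i (c i - d i) *: e i = 0.
  under eq_bigr do rewrite scalerBl.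
  by rewrite sumrB -xc -xd subrr.
rewrite (bigD1_ord k)//= => /eqP; rewrite addr_eq0 => /eqP ek.
suff : (n.+1 <= n)%N by rewrite ltnn.
apply: nmin; apply/asboolP; exists (e \o lift k) => y.
(* Since [ek] gives [(c k - d k) *: e k], the term [a k *: e k] is [q] times it; substituting shifts
   each remaining coefficient by [q] times the relation. *)
have [a ->] := eE y; pose q := a k / (c k - d k).
exists (fun j => a (lift k j) - q * (c (lift k j) - d (lift k j))).
rewrite (bigD1_ord k)//= -[a k](divfK cdk) -/q -scalerA ek.
under [RHS]eq_bigr do rewrite scalerBl -scalerA.
by rewrite sumrB -scaler_sumr scalerN addrC.
Qed.

Context (I : finType) (v : I -> E).

(** Existence of coefficients is made boolean so that the span can carry the [submodClosed]
    structure. *)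
Definition lin_span_pred : {pred E} :=
  fun y => `[< exists c : I -> R, y = \sum_i c i *: v i >].

Let lin_span_closed : subsemimod_closed lin_span_pred.
Proof.
split; first split.
- by apply/asboolP; exists (fun=> 0); rewrite big1// => i _; rewrite scale0r.
- move=> x y /asboolP[c ->] /asboolP[d ->]; apply/asboolP.
  exists (fun i => c i + d i).
  by rewrite -big_split/=; apply: eq_bigr => i _; rewrite scalerDl.
- move=> a x /asboolP[c ->]; apply/asboolP; exists (fun i => a * c i).
  by rewrite scaler_sumr; apply: eq_bigr => i _; rewrite scalerA.
Qed.

HB.instance Definition _ := GRing.isSubSemiModClosed.Build R E lin_span_pred
  lin_span_closed.

Definition lin_span : submodClosed E := lin_span_pred.

Lemma mem_lin_span i : v i \in lin_span.
Proof.
apply/asboolP; exists (fun j => (j == i)%:R).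
rewrite (bigD1 i)//= eqxx scale1r big1 ?addr0// => j /negbTE ->.
by rewrite scale0r.
Qed.

End Span.

Section SubNormedTheory.
Context (R : realType).
Implicit Types X Y : normedModType R.

Lemma continuous_sub_val X (V : submodClosed X) :
  continuous (val : sub_normed V -> X).
Proof.
move=> x; apply/(@cvgrPdist_lt _ _ _ (nbhs x)) => e e0; near=> y.
rewrite -linearB -sub_normE.
by near: y; apply: cvgr_dist_lt.
Unshelve. all: by end_near. Qed.

(** The norm of [sub_normed W] is induced by that of [Y], so distances between values of [h] can be
    measured in [Y]. *)
Lemma continuous_to_sub_normed (T : topologicalType) Y (W : submodClosed Y)
  (h : T -> sub_normed W) : continuous (val \o h) -> continuous h.
Proof.
move=> hc x; apply/(@cvgrPdist_lt _ _ _ (nbhs x)) => e e0.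
near=> y; rewrite sub_normE linearB /=.
by near: y; exact: (@cvgr_dist_lt _ _ _ (nbhs x) _ _ _ (hc x)).
Unshelve. all: by end_near. Qed.

Lemma has_dim_lin_span Y (I : finType) (v : I -> Y) :
  exists n, has_dim (sub_normed (lin_span v)) n.
Proof.
apply: (@has_dim_spanning _ _ _ (fun i => SubNormed (mem_lin_span v i))) => x.
have /asboolP[c xc] := sub_valP x; exists c; apply: val_inj.
rewrite linear_sum; rewrite [LHS]xc.
by apply: eq_bigr => i _; rewrite linearZ.
Qed.

Section Corestriction.
Context (E : lmodType R) Y (W : submodClosed Y) (L : {linear E -> Y}).
Hypothesis LW : forall x, L x \in W.

(** This turns the restriction of each [T i] to [X2] into an operator with values in the span, as
    membership of [g] in [PL] demands. *)
Definition corestrict (x : E) : sub_normed W := SubNormed (LW x).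

Let corestrict_linear : linear corestrict.
Proof. by move=> a x y; apply: val_inj; rewrite [RHS]linearP; exact: linearP. Qed.

HB.instance Definition _ := GRing.isLinear.Build R E (sub_normed W) *:%R
  corestrict corestrict_linear.

End Corestriction.

Lemma polyhedron_sub X (V : submodClosed X) (P : set X) :
  polyhedron P -> polyhedron ((val : sub_normed V -> X) @^-1` P).
Proof.
case=> n [u [s [uc ->]]]; exists n, (fun i => u i \o val), s; split=> // i.
by move=> x; apply: continuous_comp; [exact: continuous_sub_val|exact: uc].
Qed.

End SubNormedTheory.

Section PiecewiseLinearTheory.
Context (R : realType) (X Y : normedModType R).

Lemma pl_repr_piece (f : X -> Y) m (P : 'I_m -> set X)
  (T : 'I_m -> {linear X -> Y}) (b : 'I_m -> Y) :
  pl_repr f P T b -> forall x, exists i, P i x.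
Proof.
move=> [_ _ Pcov _] x.
by have : [set: X] x by []; rewrite -Pcov => -[i _ Pix]; exists i.
Qed.

(* For [h] in the lineality space of every piece, [x |-> f (x + h) - f x] equals
   [T i h] on [P i], hence is constant since [X] is connected. *)
Lemma pl_repr_lin (f : X -> Y) m (P : 'I_m -> set X)
    (T : 'I_m -> {linear X -> Y}) (b : 'I_m -> Y) (h : X) :
  pl_repr f P T b -> (\bigcap_i lin_space (P i)) h ->
  forall i x y, P i y -> f (x + h) = f x + T i h.
Proof.
move=> fr hP i x y Piy.
have [Ppoly _ Pcov fE] := fr.
(* Only the recession half of [lin_space] enters, at [t = 1]. *)
have hrec j z : P j z -> P j (z + h).
  by have [_ /(_ z 1) + Pz] := hP j I; rewrite scale1r; exact.
have DE j z : P j z -> f (z + h) - f z = T j h.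
  move=> Pz; rewrite (fE j)//; last exact: hrec.
  by rewrite (fE j z Pz) linearD [T j z + _ + b j]addrAC [LHS]addrC addKr.
pose D z := f (z + h) - f z.
have Dconst : forall y z, D y = D z.
  apply: (closed_cover_const (c := fun j => T j h)) Pcov DE.
  by move=> j; exact: polyhedron_closed.
(* The point [y] only witnesses that piece [i] is nonempty; constancy carries the value [T i h] of
   [D] from [y] to [x]. *)
by rewrite -(DE i y Piy) -[f (y + h) - _](Dconst x) /D [RHS]addrC subrK.
Qed.

End PiecewiseLinearTheory.

Theorem theorem3p2 (R : realType) (X Y : normedModType R) (f : X -> Y)
  (m : nat) (P : 'I_m -> set X) (T : 'I_m -> {linear X -> Y}) (b : 'I_m -> Y)
  (hf : PL X Y f)
  (hrepr : pl_repr f P T b)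
  (hint : forall i, interior (P i) !=set0)
  (hdisj : forall i j, i != j -> P i `&` interior (P j) = set0)
  (X1 X2 : submodClosed X)
  (hX1 : closed [set` X1]) (hX2 : closed [set` X2])
  (hX1f : [set` X1] `<=` \bigcap_i lin_space (P i))
  (hX : direct_sum X1 X2)
  (hdim : exists n, has_codim X1 n /\ has_dim (sub_normed X2) n) :
  exists (T1 : {linear sub_normed X1 -> Y}) (Yh : submodClosed Y)
         (g : sub_normed X2 -> sub_normed Yh),
    [/\ continuous T1,
        exists n, has_dim (sub_normed Yh) n,
        PL (sub_normed X2) (sub_normed Yh) g &
        forall (x1 : sub_normed X1) (x2 : sub_normed X2),
          f (val x1 + val x2) = T1 x1 + val (g x2)].
Proof.
have [_ Tc _ fE] := hrepr.
have [n [_ [e eE]]] := hdim.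
(* The point 0 serves to obtain one nonempty piece, fixed before [x1] and [x2]. *)
have [i0 Pi0] := pl_repr_piece hrepr 0.
(* A finite family whose span contains each [T i (val x) + b i] with [x] in [X2], since [e] is a
   basis of [X2]. *)
pose w (k : ('I_m * 'I_n + 'I_m)%type) : Y :=
  match k with inl (i, j) => T i (val (e j)) | inr i => b i end.
have TW i (x : sub_normed X2) : T i (val x) \in lin_span w.
  have [c [-> _]] := eE x; rewrite !linear_sum; apply: rpred_sum => j _.
  by rewrite !linearZ; apply: rpredZ; exact: (mem_lin_span w (inl (i, j))).
have bW i : b i \in lin_span w by exact: (mem_lin_span w (inr i)).
have fW (x : sub_normed X2) : f (val x) \in lin_span w.
  by have [i Pix] := pl_repr_piece hrepr (val x); rewrite (fE i)// rpredD.
exists (T i0 \o val), (lin_span w), (fun x => SubNormed (fW x)); split.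
- move=> x.
  by apply: continuous_comp; [exact: continuous_sub_val|exact: Tc].
- exact: has_dim_lin_span.
- exists m, (fun i => val @^-1` P i),
    (fun i => corestrict (L := T i \o val) (TW i)), (fun i => SubNormed (bW i)); split.
  + by move=> i; apply: polyhedron_sub; case: hrepr.
  + move=> i; apply: continuous_to_sub_normed => x.
    by apply: (continuous_comp (@continuous_sub_val _ _ X2 x)); exact: Tc.
  + apply/seteqP; split=> // x _.
    by have [i Pix] := pl_repr_piece hrepr (val x); exists i.
  + by move=> i x Pix; apply: val_inj; rewrite linearD /=; exact: fE.
- move=> x1 x2; rewrite addrC.
  (* Here the shift [h] is [val x1] and the base point is [val x2], which may lie outside [P i0]. *)
  rewrite (pl_repr_lin hrepr _ (val x2) Pi0) 1?addrC//.
  by apply: hX1f; exact: sub_valP.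
Qed.
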